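(* In $\mathsf{ZF}$, the following are equivalent: (1) $\mathsf{CC}$: every countably infinite family of non-empty sets has a choice function; (2) given sequences $(A_n)_{n\in\mathbb{N}}$, $(B_n)_{n\in\mathbb{N}}$ of non-empty sets and a sequence of injections $(f_n : A_n \to B_n)_{n\in\mathbb{N}}$, there exists a sequence of surjections $(g_n : B_n \to A_n)_{n\in\mathbb{N}}$; (3) given sequences $(A_n)_{n\in\mathbb{N}}$, $(B_n)_{n\in\mathbb{N}}$ of non-empty sets and a sequence of injections $(f_n : A_n \to B_n)_{n\in\mathbb{N}}$, there exists a sequence of functions $(h_n : B_n \to A_n)_{n\in\mathbb{N}}$. *)

(* Defs.v *)
(* A structure for the language of set theory.  Equality of sets is
   interpreted as Leibniz equality of the carrier. *)
Record set_structure : Type := SetStructure {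
  carrier :> Type;
  mem : carrier -> carrier -> Prop
}.

Arguments mem {s} _ _.

Declare Scope zf_scope.
Delimit Scope zf_scope with zf.
Infix "∈" := mem (at level 70, no associativity) : zf_scope.
Local Open Scope zf_scope.

(* First-order formulas with de Bruijn indices: under [f_all] and [f_ex],
   index 0 is the variable bound by the innermost quantifier.  They are needed
   because Separation and Replacement are schemas over first-order formulas;
   quantifying over all [M -> Prop] instead would give second-order ZF. *)
Inductive formula : Type :=
| f_mem (i j : nat)
| f_eq (i j : nat)
| f_bot
| f_imp (p q : formula)
| f_and (p q : formula)
| f_or (p q : formula)
| f_all (p : formula)
| f_ex (p : formula).

Definition scons {T : Type} (a : T) (e : nat -> T) (i : nat) : T :=
  match i with O => a | S j => e j end.

Fixpoint sat {M : set_structure} (e : nat -> M) (p : formula) : Prop :=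
  match p with
  | f_mem i j => e i ∈ e j
  | f_eq i j => e i = e j
  | f_bot => False
  | f_imp p q => sat e p -> sat e q
  | f_and p q => sat e p /\ sat e q
  | f_or p q => sat e p \/ sat e q
  | f_all p => forall a : M, sat (scons a e) p
  | f_ex p => exists a : M, sat (scons a e) p
  end.

Section Notions.
Context {M : set_structure}.
Implicit Types a b c d f g n p s w x y z A B X : M.

Definition is_empty z : Prop := forall x, ~ x ∈ z.

Definition nonempty x : Prop := exists y, y ∈ x.

Definition is_upair p a b : Prop := forall x, x ∈ p <-> x = a \/ x = b.

(* p is the Kuratowski pair {{a}, {a, b}} *)
Definition is_opair p a b : Prop :=
  forall x, x ∈ p <-> is_upair x a a \/ is_upair x a b.

(* s is n ∪ {n} *)
Definition is_succ s n : Prop := forall x, x ∈ s <-> x ∈ n \/ x = n.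

Definition inductive w : Prop :=
  (exists z, is_empty z /\ z ∈ w) /\
  (forall n, n ∈ w -> exists s, is_succ s n /\ s ∈ w).

(* The set of natural numbers of the structure M, which need not be
   isomorphic to [nat]. *)
Definition is_omega w : Prop :=
  inductive w /\ forall v : M, inductive v -> forall n, n ∈ w -> n ∈ v.

Definition app f x y : Prop := exists p, is_opair p x y /\ p ∈ f.

(* f is a function (a set of ordered pairs) whose domain is exactly a *)
Definition function_on f a : Prop :=
  (forall p, p ∈ f -> exists x y, x ∈ a /\ is_opair p x y) /\
  (forall x, x ∈ a -> exists! y, app f x y).

Definition maps f a b : Prop :=
  function_on f a /\ forall x y, app f x y -> y ∈ b.

Definition injection f a b : Prop :=
  maps f a b /\ forall x x' y, app f x y -> app f x' y -> x = x'.

Definition surjection f a b : Prop :=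
  maps f a b /\ forall y, y ∈ b -> exists x, app f x y.

Definition bijection f a b : Prop := injection f a b /\ surjection f a b.

Definition countably_infinite X : Prop :=
  exists w f, is_omega w /\ bijection f w X.

Definition choice_function f X : Prop :=
  function_on f X /\ forall x y, app f x y -> y ∈ x.

(* A is a sequence (A_n), indexed by w, of non-empty sets *)
Definition nonempty_sequence w A : Prop :=
  function_on A w /\ forall n a, app A n a -> nonempty a.

(* f is a sequence (f_n), indexed by w, such that R f_n A_n B_n for all n *)
Definition sequence_of_maps (R : M -> M -> M -> Prop) w f A B : Prop :=
  function_on f w /\
  forall n g a b, app f n g -> app A n a -> app B n b -> R g a b.

End Notions.

Record ZF (M : set_structure) : Prop := {
  zf_extensionality : forall a b : M, (forall x, x ∈ a <-> x ∈ b) -> a = b;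
  zf_foundation : forall a : M, nonempty a ->
    exists x, x ∈ a /\ forall y, y ∈ x -> ~ y ∈ a;
  zf_pairing : forall a b : M, exists p, is_upair p a b;
  zf_union : forall a : M, exists u, forall x, x ∈ u <-> exists y, y ∈ a /\ x ∈ y;
  zf_power : forall a : M, exists p, forall x, x ∈ p <-> forall y, y ∈ x -> y ∈ a;
  zf_infinity : exists w : M, inductive w;
  (* e provides the parameters of phi; index 0 stands for x *)
  zf_separation : forall (phi : formula) (e : nat -> M) (a : M),
    exists b, forall x, x ∈ b <-> x ∈ a /\ sat (scons x e) phi;
  (* index 0 stands for x and index 1 for y *)
  zf_replacement : forall (phi : formula) (e : nat -> M) (a : M),
    (forall x y y', x ∈ a -> sat (scons x (scons y e)) phi ->
       sat (scons x (scons y' e)) phi -> y = y') ->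
    exists b, forall y, y ∈ b <-> exists x, x ∈ a /\ sat (scons x (scons y e)) phi
}.

Definition CC (M : set_structure) : Prop :=
  forall X : M, countably_infinite X -> (forall x, x ∈ X -> nonempty x) ->
  exists f, choice_function f X.

Definition injections_give_surjections (M : set_structure) : Prop :=
  forall w A B f : M, is_omega w ->
  nonempty_sequence w A -> nonempty_sequence w B ->
  sequence_of_maps injection w f A B ->
  exists g, sequence_of_maps surjection w g B A.

Definition injections_give_functions (M : set_structure) : Prop :=
  forall w A B f : M, is_omega w ->
  nonempty_sequence w A -> nonempty_sequence w B ->
  sequence_of_maps injection w f A B ->
  exists h, sequence_of_maps maps w h B A.

(* Main.v *)
(* (1) => (2): an injection from a non-empty a into b yields a surjection from b
   onto a, so choosing from the sets {n} x {surjections from B_n onto A_n} gives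
   the sequence (g_n).  The factor {n} makes these sets pairwise distinct, and
   makes the range of the choice function the required sequence.
   (3) => (1): for a family (x_n) with union U, apply (3) to the inclusions
   x_n -> U.  A single u in U gives the choice x_n |-> h_n(u). *)

From Stdlib Require Import Classical.
Require Import Defs.

Local Open Scope zf_scope.

(* For every environment e, [sat e (f_notion i j ...)] is convertible to
   [notion (e i) (e j) ...]; instances of the schemas are therefore obtained
   below by stating the intended property and supplying a formula. *)
Definition f_iff (p q : formula) : formula := f_and (f_imp p q) (f_imp q p).

Definition f_upair (p a b : nat) : formula :=
  f_all (f_iff (f_mem 0 (S p)) (f_or (f_eq 0 (S a)) (f_eq 0 (S b)))).

Definition f_opair (p a b : nat) : formula :=
  f_all (f_iff (f_mem 0 (S p)) (f_or (f_upair 0 (S a) (S a)) (f_upair 0 (S a) (S b)))).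

Definition f_app (f x y : nat) : formula :=
  f_ex (f_and (f_opair 0 (S x) (S y)) (f_mem 0 (S f))).

Definition f_function_on (f a : nat) : formula :=
  f_and
    (f_all (f_imp (f_mem 0 (S f))
       (f_ex (f_ex (f_and (f_mem 1 (3 + a)) (f_opair 2 1 0))))))
    (f_all (f_imp (f_mem 0 (S a))
       (f_ex (f_and (f_app (2 + f) 1 0)
          (f_all (f_imp (f_app (3 + f) 2 0) (f_eq 1 0))))))).

Definition f_maps (f a b : nat) : formula :=
  f_and (f_function_on f a)
    (f_all (f_all (f_imp (f_app (2 + f) 1 0) (f_mem 0 (2 + b))))).

Definition f_surjection (f a b : nat) : formula :=
  f_and (f_maps f a b)
    (f_all (f_imp (f_mem 0 (S b)) (f_ex (f_app (2 + f) 0 1)))).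

Section ZFStructure.
Context {M : set_structure} (hM : ZF M).
Implicit Types a b c f g p u w x y z A B X : M.

(** * Unordered and Kuratowski pairs *)

Lemma upair_unique p q a b : is_upair p a b -> is_upair q a b -> p = q.
Proof.
  intros Hp Hq. apply (zf_extensionality M hM). intros x.
  rewrite (Hp x), (Hq x). reflexivity.
Qed.

Lemma opair_unique p q a b : is_opair p a b -> is_opair q a b -> p = q.
Proof.
  intros Hp Hq. apply (zf_extensionality M hM). intros x.
  rewrite (Hp x), (Hq x). reflexivity.
Qed.

Lemma opair_exists a b : exists p, is_opair p a b.
Proof.
  destruct (zf_pairing M hM a a) as [s Hs].
  destruct (zf_pairing M hM a b) as [t Ht].
  destruct (zf_pairing M hM s t) as [p Hp].
  exists p. intros x. rewrite (Hp x). split; intros [H|H].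
  - left; subst; exact Hs.
  - right; subst; exact Ht.
  - left; exact (upair_unique _ _ _ _ H Hs).
  - right; exact (upair_unique _ _ _ _ H Ht).
Qed.

(** The singleton {a} is an element of [p], hence equals {a'} or {a', b'}; either way it contains
    [a']. *)
Lemma opair_fst p a b a' b' : is_opair p a b -> is_opair p a' b' -> a = a'.
Proof.
  intros H H'.
  destruct (zf_pairing M hM a a) as [s Hs].
  assert (Hsp : s ∈ p) by (apply H; left; exact Hs).
  assert (Ha : a' ∈ s).
  { apply H' in Hsp. destruct Hsp as [K|K]; apply K; left; reflexivity. }
  apply Hs in Ha. destruct Ha; congruence.
Qed.

(** The element {a, b} of [p] is {a} or {a, b'}, and [b] lies in it. Used in both directions, this
    settles the degenerate case where a pair has equal coordinates. *)
Lemma opair_snd_or p a b b' : is_opair p a b -> is_opair p a b' -> b = a \/ b = b'.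
Proof.
  intros H H'.
  destruct (zf_pairing M hM a b) as [t Ht].
  assert (Htp : t ∈ p) by (apply H; right; exact Ht).
  assert (Hb : b ∈ t) by (apply Ht; right; reflexivity).
  apply H' in Htp. destruct Htp as [K|K]; apply K in Hb; tauto.
Qed.

Lemma opair_snd p a b a' b' : is_opair p a b -> is_opair p a' b' -> b = b'.
Proof.
  intros H H'. assert (a = a') by exact (opair_fst _ _ _ _ _ H H'). subst a'.
  destruct (opair_snd_or _ _ _ _ H H'), (opair_snd_or _ _ _ _ H' H); congruence.
Qed.

(** * Functions as sets of pairs, and the sets built from them *)

Lemma app_opair f p x y : is_opair p x y -> app f x y <-> p ∈ f.
Proof.
  intros Hp. split.
  - intros (q & Hq & Hqf). rewrite (opair_unique _ _ _ _ Hp Hq). exact Hqf.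
  - intros Hpf. exists p. split; assumption.
Qed.

Lemma app_dom f a x y : function_on f a -> app f x y -> x ∈ a.
Proof.
  intros [Hf _] (p & Hp & Hpf). destruct (Hf p Hpf) as (x' & y' & Hx' & Hp').
  rewrite (opair_fst _ _ _ _ _ Hp Hp'). exact Hx'.
Qed.

Lemma app_functional f a x y y' : function_on f a -> app f x y -> app f x y' -> y = y'.
Proof.
  intros Hf Hy Hy'. destruct (proj2 Hf x (app_dom _ _ _ _ Hf Hy)) as (z & _ & Hz).
  rewrite <- (Hz y Hy). apply Hz, Hy'.
Qed.

Lemma app_total f a x : function_on f a -> x ∈ a -> exists y, app f x y.
Proof.
  intros Hf Hx. destruct (proj2 Hf x Hx) as (y & Hy & _). exists y. exact Hy.
Qed.

(* In phi, index 0 stands for the value y and index 1 for the argument x.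
   Index 2 is the pair under construction, on which phi may not depend. *)
Lemma function_by_formula (phi : formula) (e : nat -> M) a (R : M -> M -> Prop) :
  (forall p x y, sat (scons y (scons x (scons p e))) phi <-> R x y) ->
  (forall x, x ∈ a -> exists! y, R x y) ->
  exists f, function_on f a /\ forall x y, app f x y <-> x ∈ a /\ R x y.
Proof.
  intros Hphi HR.
  destruct (zf_replacement M hM (f_ex (f_and phi (f_opair 2 1 0))) e a) as [f Hf].
  { intros x p p' Hx (y & Hy & Hp) (y' & Hy' & Hp').
    apply Hphi in Hy, Hy'. destruct (HR x Hx) as (z & _ & Hz).
    rewrite <- (Hz y Hy) in Hp. rewrite <- (Hz y' Hy') in Hp'.
    exact (opair_unique _ _ _ _ Hp Hp'). }
  assert (Hmem : forall p, p ∈ f <-> exists x y, x ∈ a /\ R x y /\ is_opair p x y).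
  { intros p. rewrite (Hf p). split.
    - intros (x & Hx & y & Hy & Hp). exists x, y.
      apply Hphi in Hy. repeat split; try assumption; apply Hp.
    - intros (x & y & Hx & Hy & Hp). exists x. split; [exact Hx|].
      exists y. split; [apply Hphi; exact Hy | exact Hp]. }
  assert (Happ : forall x y, app f x y <-> x ∈ a /\ R x y).
  { intros x y. destruct (opair_exists x y) as [p Hp].
    rewrite (app_opair f p x y Hp), Hmem. split.
    - intros (x' & y' & Hx & Hy & Hp').
      rewrite (opair_fst _ _ _ _ _ Hp Hp'), (opair_snd _ _ _ _ _ Hp Hp'). tauto.
    - intros [Hx Hy]. exists x, y. tauto. }
  exists f. split; [split|exact Happ].
  - intros p Hp. apply Hmem in Hp. destruct Hp as (x & y & Hx & _ & Hp).
    exists x, y. tauto.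
  - intros x Hx. destruct (HR x Hx) as (y & Hy & Hu). exists y. split.
    + apply Happ. tauto.
    + intros y' Hy'. apply Hu, Happ, Hy'.
Qed.

Lemma range_exists f a : function_on f a ->
  exists X, forall y, y ∈ X <-> exists x, app f x y.
Proof.
  intros Hf.
  destruct (zf_replacement M hM (f_app 2 0 1) (fun _ => f) a) as [X HX].
  { intros x y y' _ Hy Hy'. exact (app_functional _ _ _ _ _ Hf Hy Hy'). }
  exists X. intros y. rewrite (HX y). split.
  - intros (x & _ & Hxy). exists x. exact Hxy.
  - intros (x & Hxy). exists x. split; [exact (app_dom _ _ _ _ Hf Hxy)|exact Hxy].
Qed.

(** A Kuratowski pair with coordinates in [a] and [b] is a set of subsets of their union [u], so
    Separation carves the product out of the double power set of [u]. *)
Lemma product_exists a b :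
  exists c, forall p, p ∈ c <-> exists x y, x ∈ a /\ y ∈ b /\ is_opair p x y.
Proof.
  destruct (zf_pairing M hM a b) as [t Ht].
  destruct (zf_union M hM t) as [u Hu].
  destruct (zf_power M hM u) as [v Hv].
  destruct (zf_power M hM v) as [w Hw].
  destruct (zf_separation M hM
    (f_ex (f_ex (f_and (f_mem 1 3) (f_and (f_mem 0 4) (f_opair 2 1 0)))))
    (scons a (fun _ => b)) w) as [c Hc].
  exists c. intros p. rewrite (Hc p). split; [intros [_ H]; exact H|].
  intros H. split; [|exact H]. destruct H as (x & y & Hx & Hy & Hp).
  assert (Hxu : x ∈ u) by (apply Hu; exists a; split; [apply Ht; tauto|exact Hx]).
  assert (Hyu : y ∈ u) by (apply Hu; exists b; split; [apply Ht; tauto|exact Hy]).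
  apply Hw. intros q Hq. apply Hv. intros r Hr.
  apply Hp in Hq. destruct Hq as [Hq|Hq]; apply Hq in Hr; destruct Hr; congruence.
Qed.

(** * From choice to sequences of surjections *)

(** Invert [f] on its range and send every other point of [b] to a fixed [a0] in [a]. The case split
    on membership in the range is classical. *)
Lemma surjection_of_injection f a b :
  nonempty a -> injection f a b -> exists g, surjection g b a.
Proof.
  intros [a0 Ha0] [[Hf Hfb] Hinj].
  pose (R y x := app f x y \/ (~ (exists x', app f x' y) /\ x = a0)).
  (* Parameters start at index 3: here [f] is 3 and [a0] is 4, each shifted by one under the inner
     quantifier. *)
  destruct (function_by_formula
    (f_or (f_app 3 0 1) (f_and (f_imp (f_ex (f_app 4 0 2)) f_bot) (f_eq 0 4)))
    (scons f (fun _ => a0)) b R (fun _ _ _ => iff_refl _)) as (g & Hg & Happ).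
  { intros y Hy. destruct (classic (exists x', app f x' y)) as [[x Hx]|Hn].
    - exists x. split; [left; exact Hx|]. intros x' [Hx'|[Hn _]].
      + exact (Hinj _ _ _ Hx Hx').
      + destruct Hn. exists x. exact Hx.
    - exists a0. split; [right; tauto|]. intros x' [Hx'|[_ Hx']].
      + destruct Hn. exists x'. exact Hx'.
      + congruence. }
  exists g. split; [split; [exact Hg|]|].
  - intros y x Hyx. apply Happ in Hyx. destruct Hyx as [_ [Hx|[_ Hx]]].
    + exact (app_dom _ _ _ _ Hf Hx).
    + subst x. exact Ha0.
  - intros x Hx. destruct (app_total _ _ _ Hf Hx) as [y Hy]. exists y.
    apply Happ. split; [exact (Hfb _ _ Hy)|left; exact Hy].
Qed.

(** A surjection from [b] onto [a] is a subset of their product, so the tagged ones can be separated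
    from {n} times the power set of that product. *)
Lemma tagged_surjections_exist n a b :
  exists t, forall p, p ∈ t <-> exists g, is_opair p n g /\ surjection g b a.
Proof.
  destruct (zf_pairing M hM n n) as [s Hs].
  destruct (product_exists b a) as [c Hc].
  destruct (zf_power M hM c) as [d Hd].
  destruct (product_exists s d) as [v Hv].
  destruct (zf_separation M hM
    (f_ex (f_and (f_opair 1 2 0) (f_surjection 0 3 4)))
    (scons n (scons b (fun _ => a))) v) as [t Ht].
  exists t. intros p. rewrite (Ht p). split; [intros [_ H]; exact H|].
  intros H. split; [|exact H]. destruct H as (g & Hp & [Hg Hga] & _).
  apply Hv. exists n, g. split; [apply Hs; tauto|]. split; [|exact Hp].
  apply Hd. intros q Hq. apply Hc.
  destruct (proj1 Hg q Hq) as (y & x & Hy & Hqyx).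
  exists y, x. split; [exact Hy|]. split; [|exact Hqyx].
  apply (Hga y). exists q. tauto.
Qed.

Lemma CC_injections_give_surjections : CC M -> injections_give_surjections M.
Proof.
  intros hCC w A B f Hw [HA HAne] [HB HBne] [Hf Hinj].
  (* [R n t] fixes all elements of [t], so Extensionality gives uniqueness. The terms of the
     sequences are reached through [app], which leaves [A] and [B] as the only parameters. *)
  pose (R n t := forall p, p ∈ t <-> exists g, is_opair p n g /\
    exists b, app B n b /\ exists a, app A n a /\ surjection g b a).
  destruct (function_by_formula
    (f_all (f_iff (f_mem 0 1) (f_ex (f_and (f_opair 1 3 0)
       (f_ex (f_and (f_app 7 4 0)
         (f_ex (f_and (f_app 7 5 0) (f_surjection 2 1 0)))))))))
    (scons A (fun _ => B)) w R (fun _ _ _ => iff_refl _)) as (T & HT & HTapp).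
  { intros n Hn.
    destruct (app_total _ _ _ HA Hn) as [a Ha].
    destruct (app_total _ _ _ HB Hn) as [b Hb].
    destruct (tagged_surjections_exist n a b) as [t Ht].
    assert (HRt : R n t).
    { intros p. rewrite (Ht p). split.
      - intros (g & Hp & Hg). exists g. split; [exact Hp|].
        exists b. split; [exact Hb|]. exists a. tauto.
      - intros (g & Hp & b' & Hb' & a' & Ha' & Hg). exists g. split; [exact Hp|].
        rewrite (app_functional _ _ _ _ _ HA Ha Ha').
        rewrite (app_functional _ _ _ _ _ HB Hb Hb'). exact Hg. }
    exists t. split; [exact HRt|]. intros t' Ht'.
    apply (zf_extensionality M hM). intros p. rewrite (HRt p), (Ht' p). reflexivity. }
  assert (HTne : forall n t, app T n t -> nonempty t).
  { intros n t Hnt. apply HTapp in Hnt. destruct Hnt as [Hn Ht].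
    destruct (app_total _ _ _ HA Hn) as [a Ha].
    destruct (app_total _ _ _ HB Hn) as [b Hb].
    destruct (app_total _ _ _ Hf Hn) as [i Hi].
    destruct (surjection_of_injection i a b (HAne _ _ Ha) (Hinj _ _ _ _ Hi Ha Hb))
      as [g Hg].
    destruct (opair_exists n g) as [p Hp]. exists p. apply Ht.
    exists g. split; [exact Hp|]. exists b. split; [exact Hb|]. exists a. tauto. }
  destruct (range_exists T w HT) as [X HX].
  destruct (hCC X) as (c & Hc & HcX).
  { exists w, T. split; [exact Hw|].
    assert (Hmaps : maps T w X).
    { split; [exact HT|]. intros n t Hnt. apply HX. exists n. exact Hnt. }
    split; split; try exact Hmaps.
    (* [T] is injective: an element [p] of a common value [t] has both [n] and [m] as its first
       coordinate. *)
    - intros n m t Hn Hm. destruct (HTne n t Hn) as [p Hp].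
      apply HTapp in Hn, Hm.
      destruct (proj1 (proj2 Hn p) Hp) as (g & Hpg & _).
      destruct (proj1 (proj2 Hm p) Hp) as (h & Hph & _).
      exact (opair_fst _ _ _ _ _ Hpg Hph).
    - intros t Ht. apply HX. exact Ht. }
  { intros t Ht. apply HX in Ht. destruct Ht as [n Hn]. exact (HTne n t Hn). }
  (* Each chosen element is already a pair (n, g), so the set [G] of chosen elements is itself the
     graph of the sequence. *)
  destruct (range_exists c X Hc) as [G HG].
  assert (HGmem : forall p, p ∈ G -> exists n t g,
    n ∈ w /\ app T n t /\ app c t p /\ is_opair p n g /\
    exists b, app B n b /\ exists a, app A n a /\ surjection g b a).
  { intros p Hp. apply HG in Hp. destruct Hp as [t Htp].
    pose proof (proj1 (HX t) (app_dom _ _ _ _ Hc Htp)) as [n Hn].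
    pose proof (proj1 (HTapp n t) Hn) as [Hnw HR].
    pose proof (proj1 (HR p) (HcX _ _ Htp)) as (g & Hpg & Hg).
    exists n, t, g. tauto. }
  exists G. split; [split|].
  - intros p Hp. destruct (HGmem p Hp) as (n & t & g & Hn & _ & _ & Hpg & _).
    exists n, g. tauto.
  - intros n Hn. destruct (app_total _ _ _ HT Hn) as [t Hnt].
    assert (HtX : t ∈ X) by (apply HX; exists n; exact Hnt).
    destruct (app_total _ _ _ Hc HtX) as [p Hp].
    assert (HpG : p ∈ G) by (apply HG; exists t; exact Hp).
    pose proof (proj1 (HTapp n t) Hnt) as [_ HR].
    pose proof (proj1 (HR p) (HcX _ _ Hp)) as (g & Hpg & _).
    exists g. split; [exists p; tauto|].
    (* The tag of [q] forces its index to be [n], hence it was chosen from the same set [t]; since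
       [c] is single-valued, [q] is [p]. *)
    intros g' (q & Hq & HqG).
    destruct (HGmem q HqG) as (m & t' & g'' & _ & Ht' & Hq' & Hqm & _).
    rewrite <- (opair_fst _ _ _ _ _ Hq Hqm) in Ht'.
    rewrite <- (app_functional _ _ _ _ _ HT Hnt Ht') in Hq'.
    rewrite <- (app_functional _ _ _ _ _ Hc Hp Hq') in Hq.
    exact (opair_snd _ _ _ _ _ Hpg Hq).
  - intros n g b a (p & Hp & HpG) Hb Ha.
    destruct (HGmem p HpG) as (m & t & g' & _ & _ & _ & Hp' & b' & Hb' & a' & Ha' & Hs).
    rewrite <- (opair_fst _ _ _ _ _ Hp Hp') in Ha', Hb'.
    rewrite (opair_snd _ _ _ _ _ Hp Hp').
    rewrite (app_functional _ _ _ _ _ HA Ha Ha').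
    rewrite (app_functional _ _ _ _ _ HB Hb Hb'). exact Hs.
Qed.

Lemma surjections_give_functions :
  injections_give_surjections M -> injections_give_functions M.
Proof.
  intros H w A B f Hw HA HB Hf. destruct (H w A B f Hw HA HB Hf) as (g & Hg & Hs).
  exists g. split; [exact Hg|]. intros n h b a Hh Hb Ha. apply (Hs n h b a Hh Hb Ha).
Qed.

(** * Inclusion maps and the recovery of choice *)

(** The graph is the diagonal of [a]. Its description does not mention [b] and determines [i], which
    makes it usable in a formula defining a whole sequence of inclusions. *)
Lemma inclusion_exists a b : (forall x, x ∈ a -> x ∈ b) ->
  exists i, (forall p, p ∈ i <-> exists x, x ∈ a /\ is_opair p x x) /\ injection i a b.
Proof.
  intros Hab.
  destruct (function_by_formula (f_eq 1 0) (fun _ => a) a (fun x y => x = y)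
    (fun _ _ _ => iff_refl _)) as (i & Hi & Happ).
  { intros x _. exists x. split; [reflexivity|]. intros y Hy; exact Hy. }
  exists i. split; [|split; [split; [exact Hi|]|]].
  - intros p. split.
    + intros Hp. destruct (proj1 Hi p Hp) as (x & y & Hx & Hpxy).
      assert (Hxy : app i x y) by (exists p; tauto).
      apply Happ in Hxy. destruct Hxy as [_ Hxy]. subst y. exists x. tauto.
    + intros (x & Hx & Hp). apply (app_opair i p x x Hp), Happ. tauto.
  - intros x y Hxy. apply Happ in Hxy. destruct Hxy as [Hx Hxy]. subst y. exact (Hab x Hx).
  - intros x x' y Hx Hx'. apply Happ in Hx, Hx'. destruct Hx, Hx'; congruence.
Qed.

Lemma injections_give_functions_CC : injections_give_functions M -> CC M.
Proof.
  (* The bijection [A] from [w] onto [X] serves directly as the sequence of sets. *)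
  intros H X (w & A & Hw & [[HA HAX] HAinj] & [_ HAsurj]) HX.
  destruct (zf_union M hM X) as [U HU].
  assert (HAne : nonempty_sequence w A).
  { split; [exact HA|]. intros n a Ha. exact (HX a (HAX n a Ha)). }
  assert (HUne : nonempty U).
  { destruct Hw as [[(z & _ & Hz) _] _].
    destruct (app_total _ _ _ HA Hz) as [a Ha].
    destruct (HX a (HAX _ _ Ha)) as [u Hu].
    exists u. apply HU. exists a. split; [exact (HAX _ _ Ha)|exact Hu]. }
  assert (HAU : forall n a, app A n a -> forall x, x ∈ a -> x ∈ U).
  { intros n a Ha x Hx. apply HU. exists a. split; [exact (HAX n a Ha)|exact Hx]. }
  (* [B] is the constant sequence with value [U]. *)
  destruct (function_by_formula (f_eq 0 3) (fun _ => U) w (fun _ y => y = U)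
    (fun _ _ _ => iff_refl _)) as (B & HB & HBapp).
  { intros n _. exists U. split; [reflexivity|]. intros y Hy. congruence. }
  destruct (function_by_formula
    (f_ex (f_and (f_app 4 2 0)
      (f_all (f_iff (f_mem 0 2) (f_ex (f_and (f_mem 0 2) (f_opair 1 0 0)))))))
    (fun _ => A) w
    (fun n i => exists a, app A n a /\
       forall p, p ∈ i <-> exists x, x ∈ a /\ is_opair p x x)
    (fun _ _ _ => iff_refl _)) as (f & Hf & Hfapp).
  { intros n Hn. destruct (app_total _ _ _ HA Hn) as [a Ha].
    destruct (inclusion_exists a U (HAU n a Ha)) as (i & Hi & _).
    exists i. split; [exists a; tauto|]. intros j (a' & Ha' & Hj).
    rewrite <- (app_functional _ _ _ _ _ HA Ha Ha') in Hj.
    apply (zf_extensionality M hM). intros p. rewrite (Hi p), (Hj p). reflexivity. }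
  destruct (H w A B f Hw HAne) as (h & Hh & Hmaps).
  { split; [exact HB|]. intros n b Hb. apply HBapp in Hb. destruct Hb as [_ Hb].
    subst b. exact HUne. }
  { split; [exact Hf|]. intros n i a b Hi Ha Hb.
    apply HBapp in Hb. destruct Hb as [_ Hb]. subst b.
    apply Hfapp in Hi. destruct Hi as (_ & a' & Ha' & Hi).
    rewrite <- (app_functional _ _ _ _ _ HA Ha Ha') in Hi.
    destruct (inclusion_exists a U (HAU n a Ha)) as (j & Hj & Hinj).
    (* Both [i] and [j] are the diagonal of [a], so the injectivity known for [j] transfers to
       [i]. *)
    replace i with j; [exact Hinj|].
    apply (zf_extensionality M hM). intros p. rewrite (Hi p), (Hj p). reflexivity. }
  destruct HUne as [u Hu].
  assert (Hval : forall n g a, app A n a -> app h n g -> maps g U a).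
  { intros n g a Ha Hg. apply (Hmaps n g U a Hg); [|exact Ha].
    apply HBapp. split; [exact (app_dom _ _ _ _ HA Ha)|reflexivity]. }
  (* The choice at [x] is the value at the single point [u] of the map indexed by the [n] with A_n =
     x; no further choice is made. *)
  destruct (function_by_formula
    (f_ex (f_and (f_app 4 0 2) (f_ex (f_and (f_app 6 1 0) (f_app 0 7 2)))))
    (scons A (scons h (fun _ => u))) X
    (fun x y => exists n, app A n x /\ exists g, app h n g /\ app g u y)
    (fun _ _ _ => iff_refl _)) as (c & Hc & Hcapp).
  { intros x Hx. destruct (HAsurj x Hx) as [n Hn].
    destruct (app_total _ _ _ Hh (app_dom _ _ _ _ HA Hn)) as [g Hg].
    pose proof (proj1 (Hval n g x Hn Hg)) as Hgf.
    destruct (app_total _ _ _ Hgf Hu) as [y Hy].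
    exists y. split.
    - exists n. split; [exact Hn|]. exists g. tauto.
    - intros y' (n' & Hn' & g' & Hg' & Hy').
      (* Injectivity of the enumeration makes the index of [x] unique, so the value does not depend
         on [n]. *)
      rewrite <- (HAinj _ _ _ Hn Hn') in Hg'.
      rewrite <- (app_functional _ _ _ _ _ Hh Hg Hg') in Hy'.
      exact (app_functional _ _ _ _ _ Hgf Hy Hy'). }
  exists c. split; [exact Hc|]. intros x y Hxy.
  apply Hcapp in Hxy. destruct Hxy as (_ & n & Hn & g & Hg & Hy).
  exact (proj2 (Hval n g x Hn Hg) u y Hy).
Qed.

End ZFStructure.

Theorem theorem6p1 (M : set_structure) (hM : ZF M) :
  (CC M <-> injections_give_surjections M) /\
  (injections_give_surjections M <-> injections_give_functions M).
Proof.
  pose proof (CC_injections_give_surjections hM).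
  pose proof (@surjections_give_functions M).
  pose proof (injections_give_functions_CC hM).
  tauto.
Qed.
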